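(* Let $\mathbb{K}=\mathbb{Q}(\sqrt{-m})\subseteq\mathbb{C}$, with $m\in\mathbb{N}$ squarefree, be an imaginary-quadratic number field with discriminant $d_{\mathbb{K}}$ and ring of integers $\mathcal{O}_{\mathbb{K}}$. Then the extended Hermitian modular group of degree $2$ is given by $$\Delta_{2,\mathbb{K}}^{*}=\bigcup_{d\mid d_{\mathbb{K}},\ d\ \text{squarefree}}\Gamma_2(\mathcal{O}_{\mathbb{K}})\,W_d ,$$ where $d$ runs over the squarefree positive divisors of $d_{\mathbb{K}}$. It contains $\Gamma_2(\mathcal{O}_{\mathbb{K}})$ as a normal subgroup of index $2^{\nu}$, where $\nu:=\sharp\{p\;;\;p\text{ prime},\ p\mid d_{\mathbb{K}}\}$, and the factor group satisfies $$\Delta_{2,\mathbb{K}}^{*}/\Gamma_2(\mathcal{O}_{\mathbb{K}})\cong\mathcal{C}_2^{\nu}.$$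
   Context: $SU(2,2;\mathbb{C})$ is the group of all $M\in SL_4(\mathbb{C})$ with $\overline{M}^{tr}JM=J$, where $J=\begin{pmatrix}0&-I\\ I&0\end{pmatrix}$ with $2\times2$ blocks. $\Gamma_2(\mathcal{O}_{\mathbb{K}}):=SU(2,2;\mathbb{C})\cap\mathcal{O}_{\mathbb{K}}^{4\times4}$. For $L\in\mathcal{O}_{\mathbb{K}}^{4\times4}$, $\mathcal{I}(L)$ is the ideal of $\mathcal{O}_{\mathbb{K}}$ generated by the entries of $L$. The extended Hermitian modular group of degree $2$ is $$\Delta_{2,\mathbb{K}}^{*}:=\left\{\tfrac1u L\in SU(2,2;\mathbb{C})\;;\;L\in\mathcal{O}_{\mathbb{K}}^{4\times4},\ 0\neq u\in\mathbb{C},\ u^2\in\mathcal{O}_{\mathbb{K}},\ u^2\mathcal{O}_{\mathbb{K}}=\mathcal{I}(L)^2\right\}.$$ The discriminant is $d_{\mathbb{K}}=-m$ if $m\equiv3\pmod 4$ and $d_{\mathbb{K}}=-4m$ if $m\equiv1,2\pmod4$. For each squarefree $d\in\mathbb{N}$ dividing $d_{\mathbb{K}}$ choose $u,v\in\mathbb{Z}$ with $ud-v(m^2+m)/d=1$ (such integers exist) and set $$V_d:=\frac{1}{\sqrt d}\begin{pmatrix}ud & v(m+\sqrt{-m})\\ m-\sqrt{-m} & d\end{pmatrix}\in SL_2(\mathbb{C}),\qquad W_d:=\begin{pmatrix}\overline{V}_d^{\,tr}&0\\0&V_d^{-1}\end{pmatrix}\in SU(2,2;\mathbb{C}).$$ $\mathcal{C}_2$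 is a cyclic group of order $2$. *)

(* Defs.v *)
From HB Require Import structures.
From mathcomp Require Import all_boot all_order all_algebra.
From mathcomp Require Import classical_sets functions cardinality reals complex.

Set Implicit Arguments.
Unset Strict Implicit.
Unset Printing Implicit Defensive.

Import Order.TTheory GRing.Theory Num.Theory.

Local Open Scope classical_set_scope.
Local Open Scope sesquilinear_scope.
Local Open Scope ring_scope.

Definition squarefree (n : nat) : Prop :=
  forall k : nat, (k ^ 2 %| n)%N -> k = 1%N.

Section Groups.
Variable R : unitRingType.

Definition is_subgroup (H : set R) : Prop :=
  [/\ H `<=` [set x | x \is a GRing.unit], H 1
    & forall x y, H x -> H y -> H (x / y)].

Definition is_normal_subgroup (H G : set R) : Prop :=
  [/\ is_subgroup H, is_subgroup G, H `<=` G
    & forall g h, G g -> H h -> H (g * h / g)].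

Definition right_coset (H : set R) (g : R) : set R := [set h * g | h in H].

Definition cosets (H G : set R) : set (set R) := [set right_coset H g | g in G].

Definition setprod (A B : set R) : set R := [set a * b | a in A & b in B].

(* The factor group G / H consists of the cosets of H under the elementwise
   product of subsets, which is a group law as soon as H is normal in G. *)
Definition quotient_isog (H G : set R) (Q : groupType) : Prop :=
  exists f : set R -> Q,
    set_bij (cosets H G) [set: Q] f /\
    forall A B, cosets H G A -> cosets H G B ->
      f (setprod A B) = (f A * f B)%g.

End Groups.

(* C_2^n: the group law on {ffun 'I_n -> 'Z_2} is pointwise addition mod 2. *)
Definition C2pow (n : nat) : groupType := {ffun 'I_n -> 'Z_2}.

Section HermitianModularGroup.
Variable C : numClosedFieldType.

(* The square root of -m in the upper half-plane. *)
Definition sqrtN (m : nat) : C := 'i * sqrtC m%:R.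

Definition quad_field (m : nat) : set C :=
  [set z | exists a b : rat, z = ratr a + ratr b * sqrtN m].

Definition ring_of_integers (m : nat) : set C :=
  [set z | quad_field m z /\ integralOver (intr : int -> C) z].

Definition ideal_gen (O X : set C) : set C :=
  [set z | exists (n : nat) (a x : 'I_n -> C),
     [/\ forall i, O (a i), forall i, X (x i) & z = \sum_(i < n) a i * x i]].

Definition ideal_mul (O I J : set C) : set C :=
  ideal_gen O [set x * y | x in I & y in J].

Definition principal_ideal (O : set C) (x : C) : set C := [set x * a | a in O].

Definition integral_mx (O : set C) (L : 'M[C]_4) : Prop :=
  forall i j, O (L i j).

Definition entries_ideal (O : set C) (L : 'M[C]_4) : set C :=
  ideal_gen O [set z | exists i j, z = L i j].

Definition J4 : 'M[C]_4 := block_mx (0 : 'M_2) (- 1%:M) 1%:M (0 : 'M_2).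

Definition SU22 : set 'M[C]_4 :=
  [set M | \det M = 1 /\ M ^t* *m J4 *m M = J4].

Definition Gamma2 (m : nat) : set 'M[C]_4 :=
  SU22 `&` [set M | integral_mx (ring_of_integers m) M].

Definition Delta2 (m : nat) : set 'M[C]_4 :=
  let O := ring_of_integers m in
  [set M | SU22 M /\ exists (L : 'M[C]_4) (u : C),
     [/\ integral_mx O L, u != 0, O (u ^+ 2),
         principal_ideal O (u ^+ 2)
           = ideal_mul O (entries_ideal O L) (entries_ideal O L)
       & M = u^-1 *: L]].

Definition V_mx (m d : nat) (u v : int) : 'M[C]_2 :=
  (sqrtC d%:R)^-1 *:
    block_mx (u%:~R * d%:R)%:M  (v%:~R * (m%:R + sqrtN m))%:M
             (m%:R - sqrtN m)%:M (d%:R)%:M :> 'M_(1 + 1).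

Definition W_mx (m d : nat) (u v : int) : 'M[C]_4 :=
  block_mx ((V_mx m d u v) ^t*) 0 0 (invmx (V_mx m d u v)).

End HermitianModularGroup.

Arguments sqrtN C m : clear implicits.
Arguments quad_field C m : clear implicits.
Arguments ring_of_integers C m : clear implicits.
Arguments J4 C : clear implicits.
Arguments SU22 C : clear implicits.
Arguments Gamma2 C m : clear implicits.
Arguments Delta2 C m : clear implicits.
Arguments V_mx C m d u v : clear implicits.
Arguments W_mx C m d u v : clear implicits.

(* The discriminant of Q(sqrt(-m)); meaningful for squarefree m only. *)
Definition disc (m : nat) : int :=
  if (m %% 4 == 3)%N then - (m%:Z) else - ((4 * m)%:Z).

Definition disc_divisors (m : nat) : set nat :=
  [set d | squarefree d /\ (d%:Z %| disc m)%Z].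

(* Stated in rat, so that the division by d is not truncated. *)
Definition bezout_cond (m d : nat) (u v : int) : Prop :=
  u%:~R * d%:R - v%:~R * (m ^ 2 + m)%:R / d%:R = 1 :> rat.

Definition num_prime_divisors (m : nat) : nat := size (primes `|disc m|).

(* Main.v *)
Require Import Defs.
From HB Require Import structures.
From mathcomp Require Import all_boot all_order all_algebra.
From mathcomp Require Import classical_sets functions cardinality reals complex.
From mathcomp Require Import boolp perm all_field zify ring.

Set Implicit Arguments.
Unset Strict Implicit.
Unset Printing Implicit Defensive.

Import Order.TTheory GRing.Theory Num.Theory.

(* Since det M = 1, the Leibniz formula shows that the entries of M always
   generate the unit ideal in degree 2, so the ideal condition defining Delta
   only says that all products of two entries of M are integral; in this form
   Delta is visibly a group.  For M in Delta some sqrt(r) M with r a positive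
   integer has all its entries in K: if u is a nonzero entry, take
   sqrt(r) = |u + conj u|, or |sqrt(-m) u| if u is purely imaginary.  Dividing
   out squares, r = d is squarefree, and if a prime p | d were unramified, then
   x^2 in pO for all entries x of sqrt(d) M would force x in pO, contradicting
   det M = 1; hence d | disc.  The class of r modulo squares is a homomorphism
   on Delta with kernel Gamma, and W_d has class d. *)

Local Open Scope classical_set_scope.
Local Open Scope sesquilinear_scope.
Local Open Scope ring_scope.

(** * The ring of integers of an imaginary quadratic field *)

Lemma squarefree_gt0 n : squarefree n -> (0 < n)%N.
Proof. by case: n => // /(_ 2 isT). Qed.

(** The squared denominator of q is coprime to the squared numerator, so it divides m;
    squarefreeness makes the denominator 1. *)
Lemma squarefree_Qint (m : nat) (q : rat) :
  squarefree m -> m%:R * q ^+ 2 \is a Num.int -> q \is a Num.int.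
Proof.
move=> hm /intrP[k hk].
have hd : (denq q)%:~R != 0 :> rat by rewrite intr_eq0 denq_neq0.
have e : m%:Z * (numq q) ^+ 2 = k * (denq q) ^+ 2.
  apply: (@intr_inj rat); rewrite !intrM -hk -pmulrn -[X in _ * X ^+ 2](divq_num_den q).
  by field.
have : (`|denq q| ^ 2 %| m)%N.
  rewrite -(@Gauss_dvdl _ _ (`|numq q| ^ 2)%N).
    have -> : (m * `|numq q| ^ 2 = `|k| * `|denq q| ^ 2)%N.
      by move: e => /(congr1 absz); rewrite !abszM.
    exact: dvdn_mull.
  by rewrite coprimeXl // coprimeXr // coprime_sym coprime_num_den.
move/hm => h.
apply/intrP; exists (numq q).
by rewrite -[LHS]divq_num_den -[denq q]absz_denq h divr1.
Qed.

Lemma Qint_sqr (q : rat) : q ^+ 2 \is a Num.int -> q \is a Num.int.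
Proof.
rewrite -[q ^+ 2]mul1r; apply: (@squarefree_Qint 1).
by move=> k; rewrite dvdn1 -[1%N](exp1n 2) eqn_exp2r // => /eqP.
Qed.

Lemma conj_ratr (C : numClosedFieldType) (q : rat) :
  (ratr q : C)^* = ratr q.
Proof. by apply/CrealP; apply: rpred_rat. Qed.

(** The integer polynomial vanishes at q already over [rat], so the root can be carried over to
    [algC], where rational algebraic integers are known to be integers. *)
Lemma integral_ratr (C : numClosedFieldType) (q : rat) :
  integralOver (intr : int -> C) (ratr q) -> q \is a Num.int.
Proof.
move=> [p mon_p]; rewrite /root.
have -> : map_poly intr p = map_poly ratr (map_poly intr p : {poly rat}) :> {poly C}.
  rewrite -map_poly_comp; apply: eq_map_poly => k /=.
  by rewrite ratr_int.
rewrite horner_map fmorph_eq0 => /eqP hp.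
have : (ratr q : algC) \in Num.int.
  apply: Cint_rat_Aint; first exact: Crat_rat.
  apply: (@root_monic_Aint (map_poly intr p)).
  - have -> : map_poly intr p = map_poly ratr (map_poly intr p : {poly rat}) :> {poly algC}.
      rewrite -map_poly_comp; apply: eq_map_poly => k /=.
      by rewrite ratr_int.
    by rewrite /root horner_map hp rmorph0.
  - exact: monic_map.
  - by apply/polyOverP => i; rewrite coef_map /= rpred_int.
case/intrP=> k; rewrite -(ratr_int algC) => /fmorph_inj ->.
exact: rpred_int.
Qed.

Lemma integral_conj (C : numClosedFieldType) (x : C) :
  integralOver (intr : int -> C) x -> integralOver (intr : int -> C) x^*.
Proof.
move=> [p mon_p /rootP px0]; exists p => //; apply/rootP.
rewrite -[RHS](rmorph0 (@Num.conj_op C)) -px0 -horner_map -map_poly_comp.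
by congr (_.[_]); apply: eq_map_poly => k /=; rewrite rmorph_int.
Qed.

Section QuadField.
Variables (C : numClosedFieldType) (m : nat).
Hypothesis hm : squarefree m.

Local Notation K := (quad_field C m).
Local Notation O := (ring_of_integers C m).
Local Notation s := (sqrtN C m).

Lemma sqr_sqrtN : s ^+ 2 = - m%:R.
Proof. by rewrite /sqrtN exprMn sqrCi sqrtCK mulN1r. Qed.

Lemma conj_sqrtN : s^* = - s.
Proof.
rewrite /sqrtN rmorphM /= conjCi mulNr; congr (- (_ * _)).
by apply/CrealP; rewrite realE sqrtC_ge0 ler0n.
Qed.

Lemma sqrtN_neq0 : s != 0.
Proof.
by rewrite -sqrf_eq0 sqr_sqrtN oppr_eq0 pnatr_eq0 -lt0n squarefree_gt0.
Qed.

Lemma K_rat (q : rat) : K (ratr q).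
Proof. by exists q, 0; rewrite rmorph0 mul0r addr0. Qed.

Lemma K_int (k : int) : K k%:~R.
Proof. by rewrite -(ratr_int C k); apply: K_rat. Qed.

Lemma K_nat (k : nat) : K k%:R.
Proof. exact: (K_int k). Qed.

Lemma K_sqrtN : K s.
Proof. by exists 0, 1; rewrite rmorph0 rmorph1 mul1r add0r. Qed.

Lemma K_add x y : K x -> K y -> K (x + y).
Proof.
move=> [a [b ->]] [c [d ->]]; exists (a + c), (b + d).
by rewrite !rmorphD /=; ring.
Qed.

Lemma K_opp x : K x -> K (- x).
Proof.
by move=> [a [b ->]]; exists (- a), (- b); rewrite !rmorphN /=; ring.
Qed.

Lemma K_mul x y : K x -> K y -> K (x * y).
Proof.
move=> [a [b ->]] [c [d ->]]; exists (a * c - m%:R * (b * d)), (a * d + b * c).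
rewrite rmorphB rmorphD !rmorphM /= ratr_nat.
by rewrite -[m%:R]opprK -sqr_sqrtN; ring.
Qed.

Lemma K_conj x : K x -> K x^*.
Proof.
move=> [a [b ->]]; exists a, (- b).
by rewrite rmorphD (rmorphM _ (ratr b)) /= conj_sqrtN !conj_ratr rmorphN /=; ring.
Qed.

(** The inverse is the conjugate divided by the norm, and the norm is rational. *)
Lemma K_inv x : K x -> K x^-1.
Proof.
have [->|x0] := eqVneq x 0; first by rewrite invr0.
move=> Kx; have Kc := K_conj Kx.
have [q hq] : exists q : rat, x * x^* = ratr q.
  case: Kx => a [b ->]; exists (a ^+ 2 + m%:R * b ^+ 2).
  rewrite rmorphD (rmorphM _ (ratr b)) /= conj_sqrtN !conj_ratr.
  rewrite rmorphD !rmorphM /= ratr_nat.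
  by rewrite -[m%:R]opprK -sqr_sqrtN; ring.
have -> : x^-1 = x^* * ratr q^-1.
  have -> : ratr q^-1 = (x * x^*)^-1 by rewrite hq; apply: fmorphV.
  by rewrite invfM mulrCA mulfV ?mulr1 // conjC_eq0.
exact: K_mul Kc (K_rat _).
Qed.

Lemma K_sum (I : finType) (F : I -> C) :
  (forall i, K (F i)) -> K (\sum_i F i).
Proof. by move=> KF; elim/big_ind: _ => // [|x y]; [apply: (K_nat 0)|apply: K_add]. Qed.

Lemma O_sub_K z : O z -> K z. Proof. by case. Qed.

Lemma O_int (k : int) : O k%:~R.
Proof. by split; [apply: K_int|apply: integral_id]. Qed.

Lemma O_nat (k : nat) : O k%:R.
Proof. exact: (O_int k). Qed.

Lemma O_add x y : O x -> O y -> O (x + y).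
Proof. by move=> [Kx Ox] [Ky Oy]; split; [apply: K_add|apply: integral_add]. Qed.

Lemma O_mul x y : O x -> O y -> O (x * y).
Proof. by move=> [Kx Ox] [Ky Oy]; split; [apply: K_mul|apply: integral_mul]. Qed.

Lemma O_opp x : O x -> O (- x).
Proof. by move=> [Kx Ox]; split; [apply: K_opp|apply: integral_opp]. Qed.

Lemma O_conj x : O x -> O x^*.
Proof. by move=> [Kx Ox]; split; [apply: K_conj|apply: integral_conj]. Qed.

Lemma O_sum (I : finType) (F : I -> C) :
  (forall i, O (F i)) -> O (\sum_i F i).
Proof. by move=> OF; elim/big_ind: _ => // [|x y]; [apply: (O_nat 0)|apply: O_add]. Qed.

(** By transitivity of integrality, the trace t and the norm n may lie in O rather than in the
    integers. *)
Lemma O_root (x t n : C) : K x -> O t -> O n -> x ^+ 2 = t * x - n -> O x.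
Proof.
move=> Kx [_ It] [_ In] e; split=> //.
apply: (@integral_root_monic _ _ _ x ('X^2 - t *: 'X + n%:P)).
- rewrite monicE -addrA lead_coefDl ?lead_coefXn // size_polyXn.
  rewrite (leq_ltn_trans (size_polyD _ _)) // gtn_max size_polyN.
  by rewrite (leq_ltn_trans (size_scale_leq _ _)) ?size_polyX //
     (leq_ltn_trans (size_polyC_leq1 _)).
- by apply/rootP; rewrite !hornerE /= e; ring.
- apply/integral_poly => -[|[|[|i]]]; rewrite !coefE /=.
  + by rewrite mulr0 subr0 add0r.
  + by rewrite mulr1 add0r addr0; apply: integral_opp.
  + by rewrite mulr0 subr0 addr0; apply: integral1.
  + by rewrite mulr0 subr0 addr0; apply: integral0.
Qed.

(** O is integrally closed in K. This turns integrality of products of entries into integrality of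
    the entries themselves once they lie in K. *)
Lemma O_sqr x : K x -> O (x ^+ 2) -> O x.
Proof.
move=> Kx Ox; apply: (O_root Kx (O_nat 0) (O_opp Ox)).
by rewrite mul0r sub0r opprK.
Qed.

Lemma O_ratr q : O (ratr q) -> q \is a Num.int.
Proof. by case=> _; apply: integral_ratr. Qed.

(** Here t is the trace and k the norm of z. This description of O treats all residues of m modulo 4
    at once. *)
Lemma OP z : O z <-> exists t b k : int,
  z = (t%:~R + b%:~R * s) / 2 /\ t ^+ 2 + m%:Z * b ^+ 2 = 4 * k.
Proof.
split=> [Oz|[t [b [k [-> e]]]]]; last first.
  apply: (@O_root _ t%:~R k%:~R); try exact: O_int.
    apply: K_mul; last by apply: K_inv; apply: (K_nat 2).
    by apply: K_add (K_int _) (K_mul (K_int _) K_sqrtN).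
  have e' : t%:~R ^+ 2 + m%:R * b%:~R ^+ 2 = 4 * k%:~R :> C.
    by rewrite !pmulrn -!rmorphXn -!rmorphM -rmorphD e.
  have -> : k%:~R = (t%:~R ^+ 2 + m%:R * b%:~R ^+ 2) / 4 :> C.
    by rewrite e'; field.
  by rewrite -[m%:R]opprK -sqr_sqrtN; field.
have Oc := O_conj Oz; case: (Oz) => -[a [b ez]] _.
have ec : z^* = ratr a - ratr b * s.
  by rewrite ez rmorphD (rmorphM _ (ratr b)) /= conj_sqrtN !conj_ratr mulrN.
have /O_ratr/intrP[t ht] : O (ratr (2 * a)).
  have -> : ratr (2 * a) = z + z^* :> C; last exact: O_add.
  by rewrite ec ez rmorphM /= ratr_nat; ring.
have /O_ratr/intrP[k hk] : O (ratr (a ^+ 2 + m%:R * b ^+ 2)).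
  have -> : ratr (a ^+ 2 + m%:R * b ^+ 2) = z * z^* :> C; last exact: O_mul.
  rewrite ec ez rmorphD rmorphM /= !rmorphXn /= ratr_nat.
  by rewrite -[m%:R]opprK -sqr_sqrtN; ring.
have ek : m%:R * (2 * b) ^+ 2 = (4 * k - t ^+ 2)%:~R :> rat.
  rewrite rmorphB rmorphM rmorphXn /= -hk -ht; ring.
(* The coefficient of s need not be an integer, but its double is: m (2b)^2 equals 4k - t^2 and m is
   squarefree. *)
have /(squarefree_Qint hm)/intrP[c hc] : m%:R * (2 * b) ^+ 2 \is a Num.int.
  by rewrite ek rpred_int.
exists t, c, k; split.
  by rewrite ez -!(ratr_int C) -ht -hc !rmorphM /= ratr_nat; field.
apply: (@intr_inj rat); rewrite hc in ek.
by rewrite rmorphD !rmorphM  /= -pmulrn ek; ring.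
Qed.

Lemma K_real (z : C) : K z -> z^* = z -> exists q, z = ratr q.
Proof.
move=> [a [b ->]].
rewrite rmorphD (rmorphM _ (ratr b)) /= conj_sqrtN !conj_ratr.
move/addrI; rewrite mulrN => /eqP; rewrite eq_sym -addr_eq0 -mulr2n mulrn_eq0 /=.
rewrite mulf_eq0 (negPf sqrtN_neq0) orbF => /eqP ->.
by exists a; rewrite mul0r addr0.
Qed.

Lemma O_real z : O z -> z^* = z -> exists k : int, z = k%:~R.
Proof.
move=> Oz zr; have [q eq] := K_real (O_sub_K Oz) zr.
have /intrP[k ek] : q \is a Num.int by apply: O_ratr; rewrite -eq.
by exists k; rewrite eq ek ratr_int.
Qed.

End QuadField.

(** * Products of entries *)

(** The four factors of a Leibniz term are grouped in two pairs, so that statements about products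
    of two entries apply to each term. *)
Lemma det4 (R : comPzRingType) (M : 'M[R]_4) :
  \det M = \sum_(t : 'S_4) (-1) ^+ t *
    (M 0 (t 0) * M 1 (t 1) * (M (inord 2) (t (inord 2)) * M (inord 3) (t (inord 3)))).
Proof.
apply: eq_bigr => t _; congr (_ * _).
rewrite !big_ord_recl big_ord0 mulr1 -!mulrA.
have -> : inord 2 = lift ord0 (lift ord0 ord0) :> 'I_4.
  by apply/val_inj; rewrite /= inordK.
have -> : inord 3 = lift ord0 (lift ord0 (lift ord0 ord0)) :> 'I_4.
  by apply/val_inj; rewrite /= inordK.
by have -> : 1 = lift ord0 ord0 :> 'I_4 by apply/val_inj.
Qed.

(** * The group SU(2,2) *)

Section SU22.
Variable C : numClosedFieldType.
Implicit Types M N : 'M[C]_4.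

Local Notation J := (J4 C).

Lemma adjM n p q (A : 'M[C]_(n, p)) (B : 'M[C]_(p, q)) :
  (A *m B) ^t* = B ^t* *m A ^t*.
Proof. by rewrite trmx_mul map_mxM. Qed.

Lemma det_adj n (A : 'M[C]_n) : \det (A ^t*) = (\det A)^*.
Proof. by rewrite det_map_mx det_tr. Qed.

Lemma J4_sqr : J *m J = - 1%:M.
Proof.
rewrite /J4 (@mulmx_block _ 2 2 2 2 2 2) !mulmx0 !mul0mx mulmx1 mul1mx !addr0 !add0r.
by rewrite (@scalar_mx_block _ 2 2) (@opp_block_mx _ 2 2 2 2) !oppr0.
Qed.

Lemma SU22_unit M : SU22 C M -> M \in unitmx.
Proof. by case=> dM _; rewrite unitmxE dM unitr1. Qed.

(** Follows from the defining relation and J^2 = -1. The inverse is thus built from the conjugate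
    transpose and J alone, so integrality and rationality properties pass to it. *)
Lemma SU22_inv_eq M : SU22 C M -> M^-1 = - (J *m M ^t* *m J).
Proof.
move=> SM; have uM := SU22_unit SM; case: SM => _ e.
have e1 : - (J *m M ^t* *m J) *m M = 1%:M.
  by rewrite mulNmx -!mulmxA (mulmxA _ J) e J4_sqr opprK.
by rewrite -[LHS]mul1mx -e1 mulmxK.
Qed.

Lemma SU22_1 : SU22 C 1%:M.
Proof. by split; rewrite ?det1 // trmx1 map_mx1 mulmx1 mul1mx. Qed.

Lemma SU22_mul M N : SU22 C M -> SU22 C N -> SU22 C (M *m N).
Proof.
move=> [dM eM] [dN eN]; split; first by rewrite det_mulmx dM dN mulr1.
by rewrite adjM -!mulmxA (mulmxA J) (mulmxA (M ^t*)) (mulmxA (M ^t*)) eM mulmxA eN.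
Qed.

Lemma SU22_inv M : SU22 C M -> SU22 C M^-1.
Proof.
move=> SM; have uM := SU22_unit SM; case: SM => dM eM; split.
  by rewrite det_inv dM invr1.
rewrite -[in LHS]eM -!mulmxA mulmxV // mulmx1 mulmxA -adjM mulmxV //.
by rewrite trmx1 map_mx1 mul1mx.
Qed.

Lemma SU22_entry_neq0 M : SU22 C M -> exists i j, M i j != 0.
Proof.
move=> [dM _]; case: (pickP (fun p : 'I_4 * 'I_4 => M p.1 p.2 != 0)) => [[i j] h|h].
  by exists i, j.
suff M0 : M = 0 by move/eqP: dM; rewrite M0 det0 eq_sym oner_eq0.
by apply/matrixP=> i j; rewrite mxE; apply/eqP; move/negbFE: (h (i, j)).
Qed.

End SU22.

(** * The ideal condition as integrality of products of entries *)

Section Delta.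
Variables (C : numClosedFieldType) (m : nat).

Local Notation K := (quad_field C m).
Local Notation O := (ring_of_integers C m).
Local Notation J := (J4 C).
Implicit Types M N : 'M[C]_4.

(** Replaces the ideal condition of [Delta2]: it mentions neither L nor u and is preserved by
    products and conjugate transposes. *)
Definition prod_integral M := forall i j k l, O (M i j * M k l).

Lemma prod_integral_mul M N :
  prod_integral M -> prod_integral N -> prod_integral (M *m N).
Proof.
move=> hM hN i j k l; rewrite !mxE big_distrlr /=.
do 2![apply: O_sum => // ?].
by rewrite mulrACA; apply: O_mul.
Qed.

Lemma prod_integral_adj M : prod_integral M -> prod_integral (M ^t*).
Proof.
by move=> hM i j k l; rewrite !mxE -rmorphM; apply: O_conj.
Qed.

Lemma prod_integral_opp M : prod_integral M -> prod_integral (- M).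
Proof. by move=> hM i j k l; rewrite !mxE mulrNN. Qed.

Lemma integral_mx_prod M : integral_mx O M -> prod_integral M.
Proof. by move=> hM i j k l; apply: O_mul. Qed.

Lemma integral_J4 : integral_mx O J.
Proof.
move=> i j; rewrite !mxE.
case: splitP => ? _; rewrite !mxE; case: splitP => ? _; rewrite !mxE.
- exact: (O_nat C m 0).
- exact: O_opp (O_nat _ _ _).
- exact: O_nat.
- exact: (O_nat C m 0).
Qed.

Lemma ideal_gen_mem (X : set C) x : X x -> ideal_gen O X x.
Proof.
move=> Xx; exists 1%N, (fun=> 1), (fun=> x); split=> //.
  by move=> _; apply: (O_nat C m 1).
by rewrite big_ord1 mul1r.
Qed.

Lemma ideal_gen_finsum (X : set C) (I : finType) (a x : I -> C) :
  (forall i, O (a i)) -> (forall i, X (x i)) ->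
  ideal_gen O X (\sum_i a i * x i).
Proof.
move=> ha hx; exists #|I|, (a \o enum_val), (x \o enum_val); split=> [i|i|] /=.
- exact: ha.
- exact: hx.
- by rewrite -(@big_enum_val _ _ _ _ I (fun i => a i * x i)) /=; apply: eq_bigl => i;
  rewrite inE.
Qed.

(** From left to right, a product of two entries of L lies in I(L)^2, which is u^2 O, and division
    by u^2 gives the claim. The converse needs det M = 1 for one of the two inclusions of ideals. *)
Lemma DeltaE M : Delta2 C m M <-> SU22 C M /\ prod_integral M.
Proof.
split=> [[SM [L [u [hL u0 Ou eI eM]]]]|[SM hM]].
  split=> // i j k l; rewrite eM !mxE mulrACA -expr2 exprVn.
  have hI a b : entries_ideal O L (L a b) by apply: ideal_gen_mem; exists a, b.
  have [c Oc <-] : principal_ideal O (u ^+ 2) (L i j * L k l).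
    by rewrite eI; apply: ideal_gen_mem; exists (L i j) => //; exists (L k l).
  by rewrite mulKf // expf_neq0.
(* Any nonzero entry of M serves as u, with L = u M; then L and u^2 consist of products of two
   entries of M. *)
have [i0 [j0]] := SU22_entry_neq0 SM; have [u eu] : {u | u = M i0 j0} by exists (M i0 j0).
rewrite -eu => u0.
split=> //; exists (u *: M), u; split=> //.
- by move=> i j; rewrite mxE eu; apply: hM.
- by rewrite expr2 eu; apply: hM.
- apply/seteqP; split=> [_ [a Oa <-]|x].
    have hI i j : entries_ideal O (u *: M) (u * M i j).
      by apply: ideal_gen_mem; exists i, j; rewrite mxE.
    (* Multiply by det M = 1 and give one factor u to each entry of the second pair: these become
       entries of L, while the first pair stays as an integral coefficient. *)
    have -> : u ^+ 2 * a = \sum_(t : 'S_4)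
        ((-1) ^+ t * a * (M 0 (t 0) * M 1 (t 1))) *
        ((u * M (inord 2) (t (inord 2))) * (u * M (inord 3) (t (inord 3)))).
      transitivity (\det M * (u ^+ 2 * a)); first by rewrite (proj1 SM) mul1r.
      rewrite det4 mulr_suml.
      apply: eq_bigr => t _.
      move: (M 0 _) (M 1 _) (M (inord 2) _) (M (inord 3) _) ((-1) ^+ t) => w x y z e.
      by ring.
    apply: ideal_gen_finsum => t; last first.
      exists (u * M (inord 2) (t (inord 2))); first exact: hI.
      by exists (u * M (inord 3) (t (inord 3))); first exact: hI.
    apply: O_mul; last exact: hM.
    by apply: O_mul => //; case: (odd_perm t); [apply: (O_int C m (-1))|apply: (O_nat C m 1)].
  (* For the reverse inclusion the denominators u are cleared one factor at a time: first y/u times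
     an entry of M is integral, then y/u times z/u. *)
  have hI y : entries_ideal O (u *: M) y ->
      forall k l, O (y / u * M k l).
    move=> [n [a [z [Oa hz ->]]]] k l; rewrite !mulr_suml.
    apply: O_sum => i; have [i1 [j1 ->]] := hz i; rewrite mxE.
    have -> : a i * (u * M i1 j1) / u * M k l = a i * (M i1 j1 * M k l) by field.
    by apply: O_mul.
  have hII y z : entries_ideal O (u *: M) y -> entries_ideal O (u *: M) z ->
      O (y / u * (z / u)).
    move=> /hI hy [n [a [w [Oa hw ->]]]]; rewrite mulr_suml mulr_sumr.
    apply: O_sum => i; have [i1 [j1 ->]] := hw i; rewrite mxE.
    have -> : y / u * (a i * (u * M i1 j1) / u) = a i * (y / u * M i1 j1) by field.
    by apply: O_mul.
  move=> [n [a [z [Oa hz ->]]]].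
  exists (\sum_i a i * (z i / u ^+ 2)).
    apply: O_sum => i; apply: O_mul => //; have [y hy [w hw <-]] := hz i.
    by have -> : y * w / u ^+ 2 = y / u * (w / u) by [field]; apply: hII.
  rewrite mulr_sumr; apply: eq_bigr => i _; field; exact: u0.
- by rewrite scalerA mulVf // scale1r.
Qed.

(** The positive integer r is an invariant of M modulo squares; type 1 means that M itself has its
    entries in K. *)
Definition typed (r : nat) M := forall i j, K (sqrtC r%:R * M i j).

Lemma sqrtC_natM (r t : nat) : sqrtC (r * t)%:R = sqrtC r%:R * sqrtC t%:R :> C.
Proof. by rewrite natrM sqrtCM // nnegrE ler0n. Qed.

Lemma typed_mul r t M N : typed r M -> typed t N -> typed (r * t) (M *m N).
Proof.
move=> hM hN i j; rewrite mxE sqrtC_natM mulr_sumr; apply: K_sum => // k.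
by rewrite mulrACA; apply: K_mul.
Qed.

Lemma K_sqrt_sqr (d : nat) : sqrtC (d * d)%:R = d%:R :> C.
Proof. by rewrite sqrtC_natM -expr2 sqrtCK. Qed.

(** A square factor of the type comes out of the root as an integer, which is invertible in K. *)
Lemma typed_sqr d r M : (0 < d)%N -> typed (d * d * r) M <-> typed r M.
Proof.
move=> d0; have d1 : d%:R != 0 :> C by rewrite pnatr_eq0 -lt0n.
split=> h i j; have := h i j; rewrite sqrtC_natM K_sqrt_sqr.
  move=> /(K_mul (K_inv (K_nat C m d))); rewrite -mulrA mulKf //.
by rewrite -mulrA; apply: K_mul => //; apply: K_nat.
Qed.

Lemma typed_adj r M : typed r M -> typed r (M ^t*).
Proof.
move=> hM i j; rewrite !mxE.
have -> : sqrtC r%:R = (sqrtC r%:R)^* :> C.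
  by apply/esym/CrealP; rewrite realE sqrtC_ge0 ler0n.
by rewrite -rmorphM; apply: K_conj.
Qed.

Lemma typed_inv r M : SU22 C M -> typed r M -> typed r M^-1.
Proof.
move=> SM /typed_adj hM; rewrite (SU22_inv_eq SM) => i j.
have J1 : typed 1 J by move=> a b; rewrite sqrtC1 mul1r; apply/O_sub_K/integral_J4.
have := typed_mul (typed_mul J1 hM) J1; rewrite mul1n muln1 => /(_ i j) h.
by rewrite mxE mulrN; apply: K_opp.
Qed.

Lemma Delta_mul M N : Delta2 C m M -> Delta2 C m N -> Delta2 C m (M *m N).
Proof.
move=> /DeltaE[SM hM] /DeltaE[SN hN]; apply/DeltaE.
by split; [apply: SU22_mul|apply: prod_integral_mul].
Qed.

Lemma Delta_inv M : Delta2 C m M -> Delta2 C m M^-1.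
Proof.
move=> /DeltaE[SM hM]; apply/DeltaE; split; first exact: SU22_inv.
have hJ := integral_mx_prod integral_J4.
rewrite (SU22_inv_eq SM); apply: prod_integral_opp.
by do ?apply: prod_integral_mul => //; apply: prod_integral_adj.
Qed.

(** Entries of a type 1 matrix lie in K and have integral squares, hence are integral. *)
Lemma GammaE M : Gamma2 C m M <-> Delta2 C m M /\ typed 1 M.
Proof.
rewrite /typed sqrtC1; split=> [[SM hM]|[/DeltaE[SM hM] tM]].
  split; first by apply/DeltaE; split=> //; apply: integral_mx_prod.
  by move=> i j; rewrite mul1r; apply/O_sub_K/hM.
split=> // i j; apply: O_sqr => //; first by rewrite -[M i j]mul1r.
by rewrite expr2; apply: hM.
Qed.

End Delta.

(** * Ramified primes and the class of a matrix *)

Lemma squarefree_part n : (0 < n)%N ->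
  exists d g, [/\ squarefree d, (0 < g)%N & n = (g * g * d)%N].
Proof.
elim/ltn_ind: n => n IH n0.
have [sqf|] := pselect (squarefree n); first by exists n, 1%N; rewrite !mul1n.
rewrite /squarefree => /existsNP [k /not_implyP[/dvdnP[q eq] /eqP k1]].
have k0 : (0 < k)%N by move: n0; rewrite eq; case: (k) => //; rewrite muln0.
have q0 : (0 < q)%N by move: n0; rewrite eq; case: (q).
have [|//|d [g [sd g0 e]]] := IH q; first by
  rewrite eq ltn_Pmulr // -[1%N](exp1n 2) ltn_exp2r // ltn_neqAle eq_sym k1.
exists d, (g * k)%N; split=> //; first by rewrite muln_gt0 g0.
by rewrite eq e; nia.
Qed.

Lemma squarefree_logn_le1 p n : squarefree n -> (logn p n <= 1)%N.
Proof.
move=> sn; rewrite leqNgt; apply/negP => h.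
have pp : prime p by move: h; rewrite lognE; case: prime.
have : (p ^ 2 %| n)%N by rewrite pfactor_dvdn // squarefree_gt0.
by move/sn => p1; rewrite p1 in pp.
Qed.

Lemma squarefree_dvdn d n : squarefree d ->
  (forall p, prime p -> (p %| d)%N -> (p %| n)%N) -> (d %| n)%N.
Proof.
move=> sd h; apply/dvdn_partP => [|p]; first exact: squarefree_gt0.
rewrite mem_primes => /and3P[pp _ pd].
rewrite p_part (@dvdn_trans (p ^ 1)) //; last by rewrite expn1; apply: h.
by rewrite dvdn_exp2l // squarefree_logn_le1.
Qed.

Lemma prime_dvdz_sqr (p : nat) (x : int) :
  prime p -> (p%:Z %| x ^+ 2)%Z -> (p%:Z %| x)%Z.
Proof. by move=> pp; rewrite !dvdzE abszX Euclid_dvdX // andbT. Qed.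

(** The relation x^2 = p y in coordinates, with x = (t + b s)/2 and y = (t' + b' s)/2 of norms k and
    k'. Unless p divides the discriminant, x/p has coordinates t1, b1 of an element of O. *)
Lemma ramified_prime_arith (m p : nat) (t b k t' b' k' : int) :
    prime p -> t ^+ 2 + m%:Z * b ^+ 2 = 4 * k ->
    t' ^+ 2 + m%:Z * b' ^+ 2 = 4 * k' ->
    t ^+ 2 - m%:Z * b ^+ 2 = 2 * p%:Z * t' -> t * b = p%:Z * b' ->
  (p%:Z %| disc m)%Z \/
  exists t1 b1 k1 : int,
    [/\ t = p%:Z * t1, b = p%:Z * b1 & t1 ^+ 2 + m%:Z * b1 ^+ 2 = 4 * k1].
Proof.
move=> pp e1 e2 e3 e4.
(* Taking norms gives k^2 = p^2 k'. *)
have /(prime_dvdz_sqr pp)/dvdzP[k2 ek] : (p%:Z %| k ^+ 2)%Z.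
  apply/dvdzP; exists (p%:Z * k').
  have : 16 * k ^+ 2 = 16 * (p%:Z * k' * p%:Z).
    have -> : 16 * k ^+ 2 = (t ^+ 2 - m%:Z * b ^+ 2) ^+ 2 + 4 * m%:Z * (t * b) ^+ 2.
      by transitivity ((4 * k) ^+ 2); [ring | rewrite -e1; ring].
    rewrite e3 e4; transitivity (4 * p%:Z ^+ 2 * (4 * k')); last by ring.
    by rewrite -e2; ring.
  by apply: mulfI.
(* Taking traces gives t^2 - 2k = p t', and p divides k. *)
have /(prime_dvdz_sqr pp)/dvdzP[t1 et] : (p%:Z %| t ^+ 2)%Z.
  apply/dvdzP; exists (t' + 2 * k2).
  apply: (@mulfI _ 2) => //.
  transitivity ((t ^+ 2 + m%:Z * b ^+ 2) + (t ^+ 2 - m%:Z * b ^+ 2)).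
    by ring.
  by rewrite e1 e3 ek; ring.
have p0 : p%:Z != 0 by rewrite eqz_nat -lt0n prime_gt0.
have : (p%:Z %| m%:Z * b ^+ 2)%Z.
  apply/dvdzP; exists (4 * k2 - p%:Z * t1 ^+ 2).
  transitivity (t ^+ 2 + m%:Z * b ^+ 2 - t ^+ 2); first by ring.
  by rewrite e1 ek et; ring.
rewrite [(_ %| m%:Z * _)%Z]dvdzE abszM Euclid_dvdM // => /orP[pm|].
  left; rewrite /disc; case: ifP => _; rewrite dvdzE abszN //=.
  by rewrite dvdn_mull.
move=> /prime_dvdz_sqr-/(_ pp)/dvdzP[b1 eb].
have e5 : p%:Z * (t1 ^+ 2 + m%:Z * b1 ^+ 2) = 4 * k2.
  apply: (mulfI p0); transitivity (t ^+ 2 + m%:Z * b ^+ 2).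
    by rewrite et eb; ring.
  by rewrite e1 ek; ring.
suff [e6|[k1 e6]] : (p%:Z %| disc m)%Z \/ exists k1, t1 ^+ 2 + m%:Z * b1 ^+ 2 = 4 * k1.
- by left.
- by right; exists t1, b1, k1; rewrite et eb mulrC [_ * p%:Z]mulrC.
(* Since p times the sum is 4 k2, divisibility by 4 is immediate for odd p. For p = 2 the
   discriminant is even unless m is 3 modulo 4. *)
have [p2|podd] := even_prime pp; last first.
  right; suff /dvdzP[k1 ->] : (4 %| t1 ^+ 2 + m%:Z * b1 ^+ 2)%Z.
    by exists k1; rewrite mulrC.
  have : (4 %| p%:Z * (t1 ^+ 2 + m%:Z * b1 ^+ 2))%Z by rewrite e5 dvdz_mulr.
  rewrite Gauss_dvdzr // coprimezE.
  by rewrite -[absz 4]/(2 ^ 2)%N absz_nat coprimeXl // coprime2n.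
have [m3|m3] := boolP (m %% 4 == 3)%N; last first.
  by left; rewrite /disc (negPf m3) p2 dvdzE abszN /= dvdn_mulr.
right; have em : m%:Z = 4 * (m %/ 4)%N%:Z + 3.
  by rewrite {1}(divn_eq m 4) (eqP m3); lia.
have e6 : t1 ^+ 2 + m%:Z * b1 ^+ 2 = 2 * k2.
  by apply: (mulfI p0); rewrite e5 p2; ring.
(* The sum is even and m is odd, so t1 and b1 have the same parity. Substituting t1 = b1 + 2c and m
   = 4q + 3 then makes every term divisible by 4. *)
have /(@prime_dvdz_sqr 2 _ isT)/dvdzP[c ec] : (2%:Z %| (t1 - b1) ^+ 2)%Z.
  apply/dvdzP; exists (k2 - 2 * (m %/ 4)%N%:Z * b1 ^+ 2 - b1 ^+ 2 - t1 * b1).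
  transitivity (t1 ^+ 2 + m%:Z * b1 ^+ 2 - (m%:Z - 1) * b1 ^+ 2 - 2 * t1 * b1).
    by ring.
  by rewrite e6 em; ring.
exists (b1 ^+ 2 + b1 * c + c ^+ 2 + (m %/ 4)%N%:Z * b1 ^+ 2).
have -> : t1 = b1 + c * 2 by rewrite -ec; ring.
by rewrite em; ring.
Qed.

(** * Existence of a squarefree type dividing the discriminant *)

Section Types.
Variables (C : numClosedFieldType) (m : nat).
Hypothesis hm : squarefree m.

Local Notation K := (quad_field C m).
Local Notation O := (ring_of_integers C m).
Local Notation s := (sqrtN C m).
Local Notation J := (J4 C).
Implicit Types M N : 'M[C]_4.

Lemma quad_coord (a b a' b' : rat) :
  ratr a + ratr b * s = ratr a' + ratr b' * s -> a = a' /\ b = b'.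
Proof.
move=> e; have ec := congr1 Num.conj e.
rewrite !rmorphD !(rmorphM _ (ratr _)) /= (conj_sqrtN _ m) !conj_ratr in ec.
have s0 := sqrtN_neq0 C hm.
have ha : ratr a = ratr a' :> C.
  apply: (@mulfI _ 2); first by rewrite pnatr_eq0.
  transitivity ((ratr a + ratr b * s) + (ratr a + ratr b * - s)); first by ring.
  by rewrite e ec; ring.
split; apply: (@fmorph_inj _ _ (@ratr C)) => //.
by apply: (mulIf s0); apply: (@addrI _ (ratr a)); rewrite {2}ha.
Qed.

(** In terms of ideals: an unramified p is a product of distinct primes, so if it divides x^2 it
    divides x. The proof compares coordinates instead of factoring ideals. *)
Lemma ramified_prime (p : nat) (x y : C) :
  prime p -> K x -> O y -> x ^+ 2 = p%:R * y ->
  (p%:Z %| disc m)%Z \/ O (x / p%:R).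
Proof.
move=> pp Kx Oy e.
have /(OP hm)[t [b [k [ex e1]]]] : O x.
  by apply: O_sqr => //; rewrite e; apply: O_mul => //; apply: O_nat.
have /(OP hm)[t' [b' [k' [ey e2]]]] := Oy.
have p0 : p%:R != 0 :> C by rewrite pnatr_eq0 -lt0n prime_gt0.
have ee : ratr (t%:~R ^+ 2 - m%:R * b%:~R ^+ 2) + ratr (2 * t%:~R * b%:~R) * s =
   ratr (2 * p%:R * t'%:~R) + ratr (2 * p%:R * b'%:~R) * s.
  rewrite rmorphB !rmorphM /= !ratr_int !ratr_nat.
  transitivity (4 * x ^+ 2); last by rewrite e ey; field.
  by rewrite ex -[m%:R]opprK -sqr_sqrtN; field.
have [e3 e4] := quad_coord ee.
have [] := @ramified_prime_arith m p t b k t' b' k' pp e1 e2.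
- by apply: (@intr_inj rat); rewrite rmorphB !rmorphM /= -!pmulrn.
- apply: (@intr_inj rat); rewrite !rmorphM /= -!pmulrn.
  by apply: (@mulfI _ 2) => //; rewrite !mulrA.
- by left.
move=> [t1 [b1 [k1 [et eb e5]]]]; right; apply/(OP hm).
exists t1, b1, k1; split=> //; rewrite ex et eb !rmorphM /= -!pmulrn; field.
by rewrite p0.
Qed.

(** If a prime p divides d but not the discriminant, [ramified_prime] makes every entry of sqrt(d) M
    divisible by p. Expanding det M = 1 then shows that d/p^2 is an integer. *)
Lemma Delta_typed_squarefree d M :
  squarefree d -> Delta2 C m M -> typed m d M -> disc_divisors m d.
Proof.
move=> sd /DeltaE[SM hM] tM; split=> //.
have d0 := squarefree_gt0 sd.
have hp p : prime p -> (p %| d)%N -> (p%:Z %| disc m)%Z.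
  move=> pp pd; apply/negPn/negP => pD.
  have [q eq] := dvdnP pd.
  have p0 : p%:R != 0 :> C by rewrite pnatr_eq0 -lt0n prime_gt0.
  have hN i j : O (sqrtC d%:R * M i j / p%:R).
    have Oy : O (q%:R * M i j ^+ 2) by apply: O_mul; [apply: O_nat|rewrite expr2; apply: hM].
    have e : (sqrtC d%:R * M i j) ^+ 2 = p%:R * (q%:R * M i j ^+ 2).
      by rewrite exprMn sqrtCK eq natrM; ring.
    by have [h|//] := ramified_prime pp (tM i j) Oy e; case/negP: pD.
  have : O (d%:R / p%:R ^+ 2).
    (* Only the first pair of each Leibniz term is rescaled by sqrt(d)/p; the second pair is
       integral as it stands. *)
    have -> : d%:R / p%:R ^+ 2 = \sum_(t : 'S_4) (-1) ^+ t *
       ((sqrtC d%:R * M 0 (t 0) / p%:R) * (sqrtC d%:R * M 1 (t 1) / p%:R) *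
        (M (inord 2) (t (inord 2)) * M (inord 3) (t (inord 3)))).
      transitivity (d%:R / p%:R ^+ 2 * \det M); first by rewrite (proj1 SM) mulr1.
      rewrite det4 mulr_sumr; apply: eq_bigr => t _.
      move: (sqrtC d%:R) (sqrtCK (d%:R : C)) => f <-.
      move: (M 0 _) (M 1 _) (M (inord 2) _) (M (inord 3) _) ((-1) ^+ t) => w x y z e.
      by field.
    apply: O_sum => t; apply: O_mul.
      by case: (odd_perm t); [apply: (O_int C m (-1))|apply: (O_nat C m 1)].
    by apply: O_mul => //; apply: O_mul.
  have -> : d%:R / p%:R ^+ 2 = ratr (d%:R / p%:R ^+ 2) :> C.
    by rewrite fmorph_div rmorphXn /= !ratr_nat.
  move/O_ratr => /intrP[k hk].
  have : d%:Z = k * (p ^ 2)%N%:Z.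
    apply: (@intr_inj rat); rewrite rmorphM /= -hk -!pmulrn natrX divfK //.
    by rewrite expf_neq0 // pnatr_eq0 -lt0n prime_gt0.
  move/(congr1 absz); rewrite abszM /= => ed.
  have : (p ^ 2 %| d)%N by rewrite ed dvdn_mull.
  by move/sd => p1; rewrite p1 in pp.
by rewrite dvdzE; apply: squarefree_dvdn.
Qed.

(** A real integral square c^2 is a positive integer r, so c is sqrt(r) up to sign, and the sign
    does not affect membership in K. *)
Lemma typed_of_real (c : C) M :
  c != 0 -> c^* = c -> O (c ^+ 2) -> (forall i j, K (c * M i j)) ->
  exists2 r, (0 < r)%N & typed m r M.
Proof.
move=> c0 cr Oc hc.
have [k ek] : exists k : int, c ^+ 2 = k%:~R by apply: (O_real hm Oc); rewrite rmorphXn /= cr.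
have ek' : c ^+ 2 = `|k|%:R.
  rewrite pmulrn ek gez0_abs // -(ler0z C) -ek real_exprn_even_ge0 //.
  by apply/CrealP.
exists `|k|%N; first by rewrite -(ltr0n C) -ek' real_exprn_even_gt0 //; apply/CrealP.
have : (sqrtC `|k|%:R) ^+ 2 == c ^+ 2 by rewrite sqrtCK ek'.
rewrite eqf_sqr => /orP[]/eqP e i j; rewrite e //.
by rewrite mulNr; apply: K_opp.
Qed.

(** The entry of J in row 2, column 0 (counting from 0) is 1. Expanding it through the defining
    relation and multiplying by u conj(u) gives terms conj(u M b 2) J(b,a) (u M a 0), all
    integral. *)
Lemma Delta_norm_integral M i j : Delta2 C m M -> O (M i j * (M i j)^*).
Proof.
move=> /DeltaE[[_ eJ] hM]; set u := M i j.
have := congr1 (fun A : 'M[C]_4 => u * u^* * A (inord 2) 0) eJ.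
have -> : J (inord 2) 0 = 1.
  rewrite !mxE; case: splitP => k; rewrite inordK // => ek.
    by have := ltn_ord k; rewrite -ek.
  rewrite !mxE; case: splitP => // l el; rewrite !mxE -val_eqE /= -el.
  by case: (nat_of_ord k) ek.
rewrite mulr1 => <-; rewrite mxE mulr_sumr; apply: O_sum => a.
rewrite mxE mulr_suml mulr_sumr; apply: O_sum => b.
rewrite 2!mxE.
have -> x : u * u^* * ((M b (inord 2))^* * x * M a 0) =
   (u * M b (inord 2))^* * x * (u * M a 0) by rewrite rmorphM /=; ring.
apply: O_mul; last exact: hM.
by apply: O_mul; [apply/O_conj/hM|apply: integral_J4].
Qed.

Lemma Delta_typed M : Delta2 C m M -> exists2 r, (0 < r)%N & typed m r M.
Proof.
move=> DM; have /DeltaE[SM hM] := DM.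
have [i0 [j0]] := SU22_entry_neq0 SM; have [u eu] : {u | u = M i0 j0} by exists (M i0 j0).
rewrite -eu => u0.
have Ouu : O (u * u^*) by rewrite eu; apply: Delta_norm_integral.
have OuM i j : O (u * M i j) by rewrite eu; apply: hM.
(* Both u and its conjugate carry the entries of M into K, hence so does their sum. *)
have OcM i j : K (u^* * M i j).
  have -> : u^* * M i j = u * u^* * (u * M i j) * (u * u)^-1 by field.
  apply: K_mul; last by apply: K_inv; rewrite {2}eu; apply/O_sub_K/OuM.
  by apply: K_mul; apply: O_sub_K.
have Ou2 : O (u ^+ 2) by rewrite expr2 {2}eu; apply: OuM.
(* The real factor u + conj(u) works unless it vanishes; then u is purely imaginary, like s, and s u
   is real and nonzero. *)
have [uc|uc] := eqVneq (u + u^*) 0.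
  have eN : u^* = - u by apply/eqP; rewrite -addr_eq0 addrC uc.
  apply: (@typed_of_real (s * u)).
  - by rewrite mulf_neq0 // (sqrtN_neq0 _ hm).
  - by rewrite rmorphM /= conj_sqrtN eN mulrNN.
  - by rewrite exprMn sqr_sqrtN; apply: O_mul => //; apply/O_opp/O_nat.
  - by move=> i j; rewrite -mulrA; apply: K_mul; [apply: K_sqrtN|apply: O_sub_K].
apply: (typed_of_real uc).
- by rewrite rmorphD /= conjCK addrC.
- have -> : (u + u^*) ^+ 2 = u ^+ 2 + (u ^+ 2)^* + (u * u^* + u * u^*).
    by rewrite rmorphXn /=; ring.
  by do !apply: O_add => //; apply: O_conj.
- by move=> i j; rewrite mulrDl; apply: K_add => //; apply: O_sub_K.
Qed.

Lemma Delta_squarefree_typed M :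
  Delta2 C m M -> exists2 d, disc_divisors m d & typed m d M.
Proof.
move=> DM; have [r r0 tr] := Delta_typed DM.
have [d [g [sd g0 er]]] := squarefree_part r0.
have td : typed m d M by apply/(typed_sqr m d M g0); rewrite -er.
by exists d => //; apply: Delta_typed_squarefree td.
Qed.

End Types.

(** * The matrices W_d *)

Lemma prime_dvd_disc m p : prime p -> (p%:Z %| disc m)%Z -> (p %| m)%N || (p == 2).
Proof.
move=> pp; rewrite /disc; case: ifP => _; rewrite dvdzE abszN /= ?absz_nat.
  by move=> ->.
rewrite Euclid_dvdM // (Euclid_dvdX 2 2) // dvdn_prime2 // => /orP[]; last by move=> ->.
by rewrite andbT => ->; rewrite orbT.
Qed.

Lemma disc_divisor_dvd_2m m d : disc_divisors m d -> (d %| 2 * m)%N.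
Proof.
move=> [sd dd]; apply: squarefree_dvdn => // p pp pd.
have : (p%:Z %| disc m)%Z by apply: dvdz_trans dd; rewrite dvdzE.
move/prime_dvd_disc => /(_ pp)/orP[pm|/eqP ->]; last exact: dvdn_mulr.
exact: dvdn_mull.
Qed.

(** A prime divisor of d divides m or equals 2, and m (m + 1) is even. Hence the fraction in
    [bezout_cond] is an integer. *)
Lemma disc_divisor_dvd_m2m m d : disc_divisors m d -> (d %| m ^ 2 + m)%N.
Proof.
move=> [sd dd]; apply: squarefree_dvdn => // p pp pd.
have : (p%:Z %| disc m)%Z by apply: dvdz_trans dd; rewrite dvdzE.
rewrite -mulnn addnC -mulnS.
move/prime_dvd_disc => /(_ pp)/orP[pm|/eqP ->]; first exact: dvdn_mulr.
by rewrite dvdn2 oddM /=; case: odd.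
Qed.

(** A common prime p would have p^2 dividing m (m + 1), hence dividing m or m + 1. The first
    contradicts squarefreeness; the second forces p = 2 and m = 3 modulo 4, where the discriminant
    is odd. *)
Lemma disc_divisor_coprime m d : squarefree m -> disc_divisors m d ->
  coprime d ((m ^ 2 + m) %/ d).
Proof.
move=> sm Dd; have [sd dd] := Dd; have [q eq] := dvdnP (disc_divisor_dvd_m2m Dd).
have d0 := squarefree_gt0 sd; have m0 := squarefree_gt0 sm.
rewrite eq mulnK //; apply/negPn/negP; rewrite /coprime => g1.
have [|p pp] := @pdivP (gcdn d q).
  by rewrite ltn_neqAle eq_sym g1 gcdn_gt0 d0.
rewrite dvdn_gcd => /andP[pd pq].
have p2 : (p ^ 2 %| m * m.+1)%N by rewrite mulnS addnC mulnn eq mulnC; apply: dvdn_mul.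
have : (p%:Z %| disc m)%Z by apply: dvdz_trans dd; rewrite dvdzE.
have [pm _|pm] := boolP (p %| m)%N.
  have cp : coprime (p ^ 2) m.+1.
    by rewrite coprimeXl // prime_coprime // -addn1 dvdn_addr // dvdn1; case: (p) pp => [|[]].
  by move: p2; rewrite Gauss_dvdl // => /sm p1; rewrite p1 in pp.
have cp : coprime (p ^ 2) m by rewrite coprimeXl // prime_coprime.
rewrite Gauss_dvdr // in p2.
move=> pD; have /orP[|/eqP e2] := prime_dvd_disc pp pD; first by rewrite (negPf pm).
rewrite e2 in p2 pD pm; move: pD; rewrite /disc.
have -> : (m %% 4 == 3)%N.
  by move/dvdnP: p2 => [k ek]; apply/eqP; lia.
by rewrite dvdzE abszN /= (negPf pm).
Qed.

Lemma bezout_exists m d : squarefree m -> disc_divisors m d ->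
  exists u v, bezout_cond m d u v.
Proof.
move=> sm Dd; have [sd _] := Dd; have [q eq] := dvdnP (disc_divisor_dvd_m2m Dd).
have d0 := squarefree_gt0 sd.
have := disc_divisor_coprime sm Dd; rewrite eq mulnK // => cdq.
have := Bezoutz d%:Z q%:Z => -[u [v e]].
have {e} e : u * d%:Z + v * q%:Z = 1.
  by rewrite e; move: cdq; rewrite /gcdz /= => /eqP ->.
exists u, (- v); rewrite /bezout_cond eq natrM.
transitivity ((u * d%:Z + v * q%:Z)%:~R : rat); last by rewrite e.
rewrite intrD !intrM mulrNz -!pmulrn.
by field; rewrite pnatr_eq0 -lt0n.
Qed.

Lemma det_mx22 (R : comPzRingType) (A : 'M[R]_2) :
  \det A = A 0 0 * A 1 1 - A 0 1 * A 1 0.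
Proof.
rewrite (expand_det_row _ 0) !big_ord_recl big_ord0 /cofactor !det_mx11 !mxE /=.
have -> : lift 0 0 = 1 :> 'I_2 by apply/val_inj.
have -> : lift 1 0 = 0 :> 'I_2 by apply/val_inj.
by rewrite /= expr0 expr1 mul1r addr0 mulN1r mulrN.
Qed.

Lemma mx22_ind (R : Type) (P : R -> Prop) (A : 'M[R]_2) :
  P (A 0 0) -> P (A 0 1) -> P (A 1 0) -> P (A 1 1) -> forall i j, P (A i j).
Proof.
have ord2 (i : 'I_2) : i = 0 \/ i = 1.
  by case: i => [[|[|//]] hi]; [left|right]; apply/val_inj.
by move=> ? ? ? ? i j; case: (ord2 i) => ->; case: (ord2 j) => ->.
Qed.

Section W.
Variables (C : numClosedFieldType) (m d : nat) (u v : int).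
Hypotheses (hd : disc_divisors m d) (huv : bezout_cond m d u v).

Local Notation O := (ring_of_integers C m).
Local Notation s := (sqrtN C m).
Local Notation V := (V_mx C m d u v).
Local Notation W := (W_mx C m d u v).

Let d_neq0 : d%:R != 0 :> C.
Proof. by rewrite pnatr_eq0 -lt0n; apply: squarefree_gt0; case: hd. Qed.

Lemma V_entries :
  [/\ V 0 0 = (sqrtC d%:R)^-1 * (u%:~R * d%:R),
      V 0 1 = (sqrtC d%:R)^-1 * (v%:~R * (m%:R + s)),
      V 1 0 = (sqrtC d%:R)^-1 * (m%:R - s) & V 1 1 = (sqrtC d%:R)^-1 * d%:R].
Proof.
have e0 : 0 = lshift 1 0 :> 'I_(1 + 1) by apply/val_inj.
have e1 : 1 = rshift 1 0 :> 'I_(1 + 1) by apply/val_inj.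
rewrite /V_mx; split; rewrite mxE ?e0 ?e1.
- by rewrite block_mxEul mxE.
- by rewrite block_mxEur mxE.
- by rewrite block_mxEdl mxE.
- by rewrite block_mxEdr mxE.
Qed.

Lemma bezout_complex : u%:~R * d%:R - v%:~R * (m%:R ^+ 2 + m%:R) / d%:R = 1 :> C.
Proof.
have := congr1 (@ratr C) huv.
rewrite rmorphB fmorph_div !rmorphM /= !ratr_int !ratr_nat rmorph1.
by rewrite natrD natrX.
Qed.

(** Since (m + s)(m - s) = m^2 + m, the determinant is the left side of the Bezout condition. *)
Lemma det_V : \det V = 1.
Proof.
have [e00 e01 e10 e11] := V_entries.
rewrite det_mx22 e00 e01 e10 e11; apply: etrans bezout_complex.
move: (sqrtC d%:R) (sqrtCK (d%:R : C)) d_neq0 => f <- f0.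
transitivity (u%:~R * f ^+ 2 - v%:~R * (m%:R ^+ 2 - s ^+ 2) / f ^+ 2).
  by field; move: f0; rewrite sqrf_eq0.
by rewrite sqr_sqrtN opprK.
Qed.

(* The square of the ideal (d, m - s) is (d); this is that ideal over sqrt d. *)
Definition in_W_ideal (z : C) :=
  exists a b, [/\ O a, O b & z = (sqrtC d%:R)^-1 * (a * d%:R + b * (m%:R - s))].

Lemma O_sqrtN : O s.
Proof.
apply: O_sqr; first exact: K_sqrtN.
by rewrite sqr_sqrtN; apply/O_opp/O_nat.
Qed.

(** The element m - s is a root of X^2 - 2m X + (m^2 + m), and d divides both lower coefficients, so
    (m - s)^2 is d times an integral element. *)
Lemma in_W_ideal_mul z w : in_W_ideal z -> in_W_ideal w -> O (z * w).
Proof.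
move=> [a [b [Oa Ob ->]]] [a' [b' [Oa' Ob' ->]]].
have [e ee] := dvdnP (disc_divisor_dvd_2m hd).
have [f ef] := dvdnP (disc_divisor_dvd_m2m hd).
have ms : (m%:R - s) ^+ 2 = d%:R * (e%:R * (m%:R - s) - f%:R).
  have ee' : 2 * m%:R = e%:R * d%:R :> C by rewrite -!natrM ee.
  have ef' : m%:R ^+ 2 + m%:R = f%:R * d%:R :> C by rewrite -natrM -ef natrD natrX.
  transitivity (2 * m%:R * (m%:R - s) - (m%:R ^+ 2 + m%:R)); last by rewrite ee' ef'; ring.
  transitivity (m%:R ^+ 2 - 2 * m%:R * s + s ^+ 2); first by ring.
  by rewrite sqr_sqrtN; ring.
have -> : (sqrtC d%:R)^-1 * (a * d%:R + b * (m%:R - s)) *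
    ((sqrtC d%:R)^-1 * (a' * d%:R + b' * (m%:R - s))) =
    a * a' * d%:R + (a * b' + a' * b) * (m%:R - s) + b * b' * (e%:R * (m%:R - s) - f%:R).
  transitivity ((sqrtC d%:R ^+ 2)^-1 *
    ((a * d%:R + b * (m%:R - s)) * (a' * d%:R + b' * (m%:R - s)))).
    by rewrite -exprVn; ring.
  rewrite sqrtCK.
  transitivity (d%:R^-1 * (d%:R * (a * a' * d%:R +
    (a * b' + a' * b) * (m%:R - s)) + b * b' * (m%:R - s) ^+ 2)); first by ring.
  by rewrite ms; field.
have Oms : O (m%:R - s) by apply: O_add; [apply: O_nat|apply/O_opp/O_sqrtN].
have On k := O_nat C m k.
by do ![exact: On|exact: Oms|exact: O_mul|apply: O_add|apply: O_mul|apply: O_opp].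
Qed.

Lemma in_W_ideal_scale a z : O a -> in_W_ideal z -> in_W_ideal (a * z).
Proof.
move=> Oa [b [c [Ob Oc ->]]]; exists (a * b), (a * c).
by split; [apply: O_mul|apply: O_mul|ring].
Qed.

Lemma in_W_ideal_d : in_W_ideal ((sqrtC d%:R)^-1 * d%:R).
Proof.
by exists 1, 0; split; [apply: (O_nat C m 1)|apply: (O_nat C m 0)|ring].
Qed.

Lemma in_W_ideal_subs : in_W_ideal ((sqrtC d%:R)^-1 * (m%:R - s)).
Proof.
by exists 0, 1; split; [apply: (O_nat C m 0)|apply: (O_nat C m 1)|ring].
Qed.

(** Because d divides 2m and m + s = 2m - (m - s). The same identity gives stability under
    conjugation. *)
Lemma in_W_ideal_adds : in_W_ideal ((sqrtC d%:R)^-1 * (m%:R + s)).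
Proof.
have [e ee] := dvdnP (disc_divisor_dvd_2m hd).
exists e%:R, (- 1); split; [exact: O_nat|exact/O_opp/(O_nat C m 1)|].
by rewrite -natrM -ee natrM; ring.
Qed.

Lemma in_W_ideal_V i j : in_W_ideal (V i j).
Proof.
move: i j; have [e00 e01 e10 e11] := V_entries; apply: mx22_ind.
- by rewrite e00 mulrCA; apply: in_W_ideal_scale (O_int _ _ _) in_W_ideal_d.
- by rewrite e01 mulrCA; apply: in_W_ideal_scale (O_int _ _ _) in_W_ideal_adds.
- by rewrite e10; apply: in_W_ideal_subs.
- by rewrite e11; apply: in_W_ideal_d.
Qed.

Lemma in_W_ideal_conj z : in_W_ideal z -> in_W_ideal z^*.
Proof.
have [e ee] := dvdnP (disc_divisor_dvd_2m hd).
move=> [a [b [Oa Ob ->]]]; exists (a^* + b^* * e%:R), (- b^*); split.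
- by apply: O_add; [exact: O_conj|apply: O_mul; [exact: O_conj|exact: O_nat]].
- exact/O_opp/O_conj.
have rd : (sqrtC d%:R)^* = sqrtC d%:R :> C.
  by apply/CrealP; rewrite realE sqrtC_ge0 ler0n.
rewrite rmorphM fmorphV /= rd rmorphD !rmorphM rmorphB /= conj_sqrtN !rmorph_nat.
rewrite mulrDl -(mulrA _ e%:R) -natrM -ee natrM; ring.
Qed.

(** As det V = 1, the inverse is the adjugate, whose entries are those of V up to sign. *)
Lemma in_W_ideal_invV i j : in_W_ideal (invmx V i j).
Proof.
rewrite /invmx unitmxE det_V unitr1 invr1 scale1r mxE /cofactor det_mx11 2!mxE.
apply: in_W_ideal_scale; last exact: in_W_ideal_V.
by rewrite -signr_odd; case: odd; [apply/O_opp/(O_nat C m 1)|apply: (O_nat C m 1)].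
Qed.

Lemma in_W_ideal_W i j : in_W_ideal (W i j).
Proof.
have T0 : in_W_ideal 0.
  rewrite -(mul0r ((sqrtC d%:R)^-1 * d%:R)).
  by apply: in_W_ideal_scale in_W_ideal_d; apply: (O_nat C m 0).
rewrite /W_mx mxE; case: splitP => k _; rewrite mxE; case: splitP => l _.
- by rewrite 2!mxE; apply/in_W_ideal_conj/in_W_ideal_V.
- by rewrite mxE.
- by rewrite mxE.
- exact: in_W_ideal_invV.
Qed.

Lemma SU22_W : SU22 C W.
Proof.
have uV : V \in unitmx by rewrite unitmxE det_V unitr1.
split.
  rewrite /W_mx (@det_ublock _ 2 2) det_adj det_inv det_V.
  by rewrite rmorph1 invr1 mulr1.
rewrite /W_mx /J4 (@tr_block_mx _ 2 2 2 2) (@map_block_mx _ _ _ 2 2 2 2).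
rewrite !(@mulmx_block _ 2 2 2 2 2 2).
rewrite trmxCK !trmx0 !map_mx0 !(mulmx0, mul0mx, addr0, add0r, mulmx1, mulmxN, mulNmx, mul1mx).
by rewrite mulmxV // -adjM mulmxV // trmx1 map_mx1.
Qed.

Lemma Delta_W : Delta2 C m W.
Proof.
apply/DeltaE; split; first exact: SU22_W.
by move=> i j k l; apply: in_W_ideal_mul; apply: in_W_ideal_W.
Qed.

Lemma typed_W : typed m d W.
Proof.
move=> i j; have [a [b [Oa Ob ->]]] := in_W_ideal_W i j.
have sd0 : sqrtC d%:R != 0 :> C by rewrite sqrtC_eq0.
rewrite mulVKf //; apply: O_sub_K; apply: O_add; apply: O_mul => //.
  exact: O_nat.
by apply: O_add; [apply: O_nat|apply/O_opp/O_sqrtN].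
Qed.

End W.

(** * The factor group *)

Section Quotient.
Variables (R : unitRingType) (G H : set R) (Q : groupType) (phi : R -> Q).
Hypotheses (subG : is_subgroup G)
  (phiM : forall x y, G x -> G y -> phi (x * y) = (phi x * phi y)%g)
  (kerphi : forall x, H x <-> G x /\ phi x = 1%g)
  (surjphi : forall q, exists2 x, G x & phi x = q).

Let unitG x : G x -> x \is a GRing.unit. Proof. by case: subG => + _ _; apply. Qed.
Let G1 : G 1. Proof. by case: subG. Qed.
Let divG x y : G x -> G y -> G (x / y). Proof. by case: subG => _ _; apply. Qed.
Let invG x : G x -> G x^-1. Proof. by rewrite -div1r; apply: divG. Qed.
Let mulG x y : G x -> G y -> G (x * y).
Proof. by move=> Gx Gy; rewrite -[y]invrK; apply/divG/invG. Qed.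

Let phi1 : phi 1 = 1%g.
Proof. by apply: (@mulgI _ (phi 1)); rewrite -phiM // mulr1 mulg1. Qed.

Let phiV x : G x -> phi x^-1 = (phi x)^-1%g.
Proof.
move=> Gx; apply: (@mulgI _ (phi x)).
by rewrite -phiM ?mulrV ?mulgV //; [apply: unitG|apply: invG].
Qed.

Lemma kernel_normal : is_normal_subgroup H G.
Proof.
split=> //.
- split; first by move=> x /kerphi[/unitG].
    by apply/kerphi.
  move=> x y /kerphi[Gx px] /kerphi[Gy py]; apply/kerphi; split; first exact: divG.
  by rewrite phiM ?phiV //; [rewrite px py invg1 mulg1|apply: invG].
- by move=> x /kerphi[].
move=> g h Gg /kerphi[Gh ph]; apply/kerphi; split.
  by apply: divG => //; apply: mulG.
by rewrite phiM ?phiV ?phiM ?ph ?mulg1 ?mulgV //; [apply: mulG|apply: invG].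
Qed.

(** Evaluates phi at a chosen element of A; the default 0 concerns only the empty set, which is not
    a coset. *)
Definition coset_value (A : set R) : Q := phi (xget 0 A).

Lemma coset_valueE A x : cosets H G A -> A x -> coset_value A = phi x.
Proof.
move=> [g Gg <-] [h /kerphi[Gh ph] <-]; rewrite /coset_value.
have : right_coset H g (xget 0 (right_coset H g)).
  by apply: xgetPex; exists (h * g); exists h => //; apply/kerphi.
move=> [h' /kerphi[Gh' ph'] <-].
by rewrite !phiM // ph ph'.
Qed.

Lemma coset_rep g : H 1 -> right_coset H g g.
Proof. by move=> H1; exists 1 => //; rewrite mul1r. Qed.

Let H1 : H 1. Proof. exact/kerphi. Qed.

Lemma coset_value_bij : set_bij (cosets H G) [set: Q] coset_value.
Proof.
split=> //.
- move=> A B; rewrite !inE => CA CB.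
  have [[g Gg eA] [k Gk eB]] := (CA, CB).
  rewrite (coset_valueE CA (_ : A g)); last by rewrite -eA; apply: coset_rep.
  rewrite (coset_valueE CB (_ : B k)); last by rewrite -eB; apply: coset_rep.
  move=> e; rewrite -eA -eB; apply/seteqP.
  have sub g1 g2 : G g1 -> G g2 -> phi g1 = phi g2 -> right_coset H g1 `<=` right_coset H g2.
    move=> Gg1 Gg2 e12 _ [h /kerphi[Gh ph] <-]; exists (h * g1 / g2).
      apply/kerphi; split; first by apply: divG => //; apply: mulG.
      by rewrite phiM ?phiV ?phiM ?ph ?mul1g ?e12 ?mulgV //; [apply: mulG|apply: invG].
    by rewrite divrK //; apply: unitG.
  by split; apply: sub.
- move=> q _; have [x Gx <-] := surjphi q.
  exists (right_coset H x); first by exists x.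
  by apply: coset_valueE; [exists x|apply: coset_rep].
Qed.

(** The element chosen in the product set is a product of elements of A and B, so multiplicativity
    of phi suffices. *)
Lemma coset_valueM A B : cosets H G A -> cosets H G B ->
  coset_value (setprod A B) = (coset_value A * coset_value B)%g.
Proof.
move=> CA CB; have [[g Gg eA] [k Gk eB]] := (CA, CB).
have Ag : A g by rewrite -eA; apply: coset_rep.
have Bk : B k by rewrite -eB; apply: coset_rep.
have : setprod A B (xget 0 (setprod A B)).
  by apply: xgetPex; exists (g * k); exists g => //; exists k.
rewrite {1}/coset_value; move: (xget _ _) => z [a Aa [b Bb <-]].
rewrite (coset_valueE CA Aa) (coset_valueE CB Bb) phiM //.
  by move: Aa; rewrite -eA => -[h /kerphi[Gh _] <-]; apply: mulG.
by move: Bb; rewrite -eB => -[h /kerphi[Gh _] <-]; apply: mulG.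
Qed.

End Quotient.

Lemma set_bij_card_finType (T : Type) (U : finType) (A : set T) (f : T -> U) :
  set_bij A [set: U] f -> (A #= `I_#|U|)%card.
Proof.
move=> [_ finj fsurj]; apply/card_set_bijP.
exists (fun x => val (enum_rank (f x))); split.
- by move=> x _; apply: ltn_ord.
- by move=> x y Ax Ay /val_inj/enum_rank_inj; apply: finj.
- move=> n n_lt; have [x Ax fx] := fsurj (enum_val (Ordinal n_lt)) I.
  by exists x => //; rewrite fx enum_valK.
Qed.

Lemma Zp2_natE (a b : nat) : odd a = odd b -> a%:R = b%:R :> 'Z_2.
Proof. by move=> e; apply/val_inj; rewrite !Zp_nat /= !modn2 e. Qed.

Lemma prod_primes_gt0 (l : seq nat) : all prime l -> (0 < \prod_(p <- l) p)%N.
Proof.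
move=> /allP al; rewrite big_seq; elim/big_ind: _ => // [a b a0 b0|p /al/prime_gt0 //].
by rewrite muln_gt0 a0.
Qed.

Lemma logn_prod_primes (l : seq nat) q :
  uniq l -> all prime l -> prime q -> logn q (\prod_(p <- l) p) = (q \in l).
Proof.
move=> + + pq; elim: l => [|p l IH] /=; first by rewrite big_nil logn1.
move=> /andP[pl ul] /andP[pp al].
rewrite big_cons lognM; [|exact: prime_gt0|exact: prod_primes_gt0].
rewrite IH // logn_prime // inE; case: eqVneq => //= ->.
by rewrite (negPf pl).
Qed.

(** * The type as a homomorphism onto an elementary abelian 2-group *)

Section Phi.
Variables (C : numClosedFieldType) (m : nat).
Hypothesis hm : squarefree m.

Local Notation K := (quad_field C m).
Local Notation Delta := (Delta2 C m).
Local Notation Gamma := (Gamma2 C m).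
Local Notation nu := (num_prime_divisors m).
Local Notation ps := (primes `|disc m|).
Implicit Types M N : 'M[C]_4.

Lemma disc_gt0 : (0 < `|disc m|)%N.
Proof.
have := squarefree_gt0 hm; rewrite /disc; case: ifP => _; rewrite abszN //=.
by rewrite muln_gt0.
Qed.

(** For a nonzero entry x, sqrt(r t) is (sqrt(r) x)(sqrt(t) x)/x^2, which lies in K. Being real it
    is rational, so r t is a perfect square. *)
Lemma typed_parity M r t p : Delta M -> (0 < r)%N -> (0 < t)%N ->
  typed m r M -> typed m t M -> odd (logn p r) = odd (logn p t).
Proof.
move=> /DeltaE[SM hM] r0 t0 hr ht.
have [i [j x0]] := SU22_entry_neq0 SM; set x := M i j in x0.
have Kq : K (sqrtC (r * t)%:R).
  have -> : sqrtC (r * t)%:R = (sqrtC r%:R * x) * (sqrtC t%:R * x) * (x * x)^-1.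
    by rewrite sqrtC_natM; field.
  apply: K_mul; first exact: K_mul (hr i j) (ht i j).
  by apply: K_inv; apply: O_sub_K; apply: hM.
have rq : (sqrtC (r * t)%:R)^* = sqrtC (r * t)%:R :> C.
  by apply/CrealP; rewrite realE sqrtC_ge0 ler0n.
have [q eq] := K_real hm Kq rq.
have eq2 : q ^+ 2 = (r * t)%:R.
  apply: (@fmorph_inj _ _ (@ratr C)).
  by rewrite rmorphXn /= -eq sqrtCK ratr_nat.
have /intrP[k ek] : q \is a Num.int by apply: Qint_sqr; rewrite eq2.
have e : (r * t = `|k| ^ 2)%N.
  rewrite -abszX; suff <- : (r * t)%N%:Z = k ^+ 2 by [].
  by apply: (@intr_inj rat); rewrite rmorphXn /= -ek eq2.
have := congr1 (fun n => odd (logn p n)) e.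
rewrite lognM // lognX oddM /= oddD.
by case: odd; case: odd.
Qed.

(** Records the class of r modulo squares by the parities of its exponents at the primes dividing
    the discriminant. On Delta some r always exists, and by [typed_parity] its choice is
    immaterial. *)
Definition delta_type M : C2pow nu :=
  [ffun i : 'I_nu => (logn (nth 0%N ps i) (xget 0%N [set r | (0 < r)%N /\ typed m r M]))%:R].

Lemma delta_typeE M r i : Delta M -> (0 < r)%N -> typed m r M ->
  delta_type M i = (logn (nth 0%N ps i) r)%:R.
Proof.
move=> DM r0 tr; rewrite ffunE; apply: Zp2_natE.
have [] : [set r | (0 < r)%N /\ typed m r M] (xget 0%N [set r | (0 < r)%N /\ typed m r M]).
  by apply: xgetPex; exists r.
by move=> x0 tx; apply: (@typed_parity M).
Qed.

Lemma delta_typeM M N : Delta M -> Delta N ->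
  delta_type (M * N) = (delta_type M * delta_type N)%g.
Proof.
move=> DM DN; have [r r0 tr] := Delta_typed hm DM; have [t t0 tt] := Delta_typed hm DN.
apply/ffunP => i; rewrite [RHS]ffunE.
rewrite (@delta_typeE _ (r * t)%N) //;
  [|exact: Delta_mul|by rewrite muln_gt0 r0|exact: typed_mul].
by rewrite (delta_typeE _ DM r0 tr) (delta_typeE _ DN t0 tt) lognM // natrD.
Qed.

(** A matrix in Delta has a squarefree type d dividing the discriminant; if all recorded parities
    vanish, no prime divides d, so d = 1. *)
Lemma delta_type_ker M : Gamma M <-> Delta M /\ delta_type M = 1%g.
Proof.
split=> [/GammaE[DM t1]|[DM e]].
  split=> //; apply/ffunP=> i.
  by rewrite (delta_typeE _ DM _ t1) // logn1 ffunE.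
apply/GammaE; split=> //.
have [d [sd dD] td] := Delta_squarefree_typed hm DM.
have d0 := squarefree_gt0 sd.
suff d1 : d = 1%N by rewrite d1 in td.
apply/eqP/negPn/negP => d1.
have [|p pp pd] := @pdivP d; first by rewrite ltn_neqAle eq_sym d1.
have pD : p \in ps.
  by rewrite mem_primes pp disc_gt0; move: dD; rewrite dvdzE; apply: dvdn_trans.
have iD : (index p ps < nu)%N by rewrite /num_prime_divisors index_mem.
have := congr1 (fun f : C2pow nu => f (Ordinal iD)) e.
rewrite (delta_typeE _ DM d0 td) /= nth_index // ffunE.
have -> : logn p d = 1%N.
  by apply/eqP; rewrite eqn_leq squarefree_logn_le1 // -pfactor_dvdn // expn1.
by move/eqP.
Qed.

(** With d the product of the primes at which g is nonzero, W_d is a preimage since it has type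
    d. *)
Lemma delta_type_surj (g : C2pow nu) : exists2 M, Delta M & delta_type M = g.
Proof.
pose b p := [exists i : 'I_nu, (nth 0%N ps i == p) && (g i != 0)].
pose d := (\prod_(p <- [seq p <- ps | b p]) p)%N.
have pps p : p \in ps -> prime p by rewrite mem_primes => /and3P[].
have allps : all prime [seq p <- ps | b p].
  by apply/allP => q; rewrite mem_filter => /andP[_ /pps].
have ld p : prime p -> logn p d = (p \in ps) && b p :> nat.
  move=> pp; rewrite logn_prod_primes ?filter_uniq ?primes_uniq //.
  by rewrite mem_filter andbC.
have d0 : (0 < d)%N by apply: prod_primes_gt0.
have sd : squarefree d.
  move=> k kd; apply/eqP/negPn/negP => k1.
  have k0 : (0 < k)%N by case: (k) kd => //; rewrite dvd0n => /eqP e; rewrite e in d0.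
  have [|p pp pk] := @pdivP k; first by rewrite ltn_neqAle eq_sym k1.
  have : (p ^ 2 %| d)%N by apply: dvdn_trans kd; rewrite dvdn_exp2r.
  by rewrite pfactor_dvdn // ld //; case: andb.
have Dd : disc_divisors m d.
  split=> //; rewrite dvdzE; apply: squarefree_dvdn => // p pp.
  rewrite -[p in (p %| d)%N]expn1 pfactor_dvdn // ld //.
  by rewrite mem_primes; case: (p %| _)%N => //; rewrite !andbF.
have [u [v huv]] := bezout_exists hm Dd.
exists (W_mx C m d u v); first exact: Delta_W.
apply/ffunP => i.
rewrite (delta_typeE _ (Delta_W C Dd huv) d0 (typed_W C Dd huv)).
have iD : nth 0%N ps i \in ps by apply: mem_nth; apply: ltn_ord.
rewrite ld ?pps // iD /=.
have -> : b (nth 0%N ps i) = (g i != 0).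
  apply/existsP/idP => [[j /andP[]]|gi]; last by exists i; rewrite eqxx.
  rewrite nth_uniq ?primes_uniq //; try exact: ltn_ord.
  by move=> /eqP/val_inj ->.
by case: (g i) => -[|[|//]] h; apply/val_inj.
Qed.

Lemma Delta_subgroup : is_subgroup Delta.
Proof.
split.
- by move=> M /DeltaE[/SU22_unit uM _].
- apply/DeltaE; split; first exact: SU22_1.
  by apply: integral_mx_prod => i j; rewrite mxE; apply: O_nat.
- by move=> M N DM DN; apply: Delta_mul => //; apply: Delta_inv.
Qed.

(** If M has type d, then M times the inverse of W_d has type d^2, equivalently type 1, and so lies
    in Gamma. *)
Lemma Delta_decomposition (u v : nat -> int) :
  (forall d, disc_divisors m d -> bezout_cond m d (u d) (v d)) ->
  Delta = \bigcup_(d in disc_divisors m)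
            right_coset Gamma (W_mx C m d (u d) (v d)).
Proof.
move=> huv; apply/seteqP; split=> [M DM|_ [d Dd [M /GammaE[DM _] <-]]]; last first.
  exact: (Delta_mul DM (Delta_W C Dd (huv d Dd))).
have [d Dd td] := Delta_squarefree_typed hm DM.
have d0 : (0 < d)%N by apply: squarefree_gt0; case: Dd.
exists d => //; set W := W_mx _ _ _ _ _.
have DW : Delta W by apply: Delta_W => //; apply: huv.
have tW : typed m d W by apply: typed_W => //; apply: huv.
have SW : SU22 C W by case/DeltaE: DW.
exists (M * W^-1); last by rewrite divrK // (SU22_unit SW).
apply/GammaE; split; first by apply: Delta_mul => //; apply: Delta_inv.
by apply/(typed_sqr m 1 _ d0); rewrite muln1; apply: typed_mul => //; apply: typed_inv.
Qed.

End Phi.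

Theorem theorem2 (R : realType) (m : nat) (hm : squarefree m) :
  let Gamma := Gamma2 R[i] m in
  let Delta := Delta2 R[i] m in
  let nu := num_prime_divisors m in
  [/\ forall u v : nat -> int,
        (forall d, disc_divisors m d -> bezout_cond m d (u d) (v d)) ->
        Delta = \bigcup_(d in disc_divisors m)
                  right_coset Gamma (W_mx R[i] m d (u d) (v d)),
      is_normal_subgroup Gamma Delta,
      (cosets Gamma Delta #= `I_(2 ^ nu))%card
    & quotient_isog Gamma Delta (C2pow nu)].
Proof.
move=> Gamma Delta nu.
have subD := Delta_subgroup R[i] m.
have dM := @delta_typeM R[i] m hm.
have dK := delta_type_ker (C := R[i]) hm.
have dS := delta_type_surj R[i] hm.
have bij := coset_value_bij subD dM dK dS.
split.
- exact: Delta_decomposition.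
- exact: kernel_normal subD dM dK.
- have := set_bij_card_finType bij.
  by rewrite card_ffun !card_ord.
- by exists (coset_value (@delta_type R[i] m)); split=> //; apply: coset_valueM subD dM dK.
Qed.
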